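(* Let $G$ be a connected graph of order $n$ with $n\geq 3$. Then $\kappa_3(G)=n-2$ if and only if $G=K_n$ or $G=K_n\setminus e$, where $K_n\setminus e$ denotes the graph obtained from the complete graph $K_n$ by deleting one edge $e$ (equality of graphs is up to isomorphism).
   Context: All graphs are undirected, finite and simple; the order of a graph is its number of vertices. For a nonempty set $S\subseteq V(G)$, an $S$-tree (a tree connecting $S$) in $G$ is a subgraph $T$ of $G$ that is a tree with $S\subseteq V(T)$. A collection $T_1,\dots,T_\ell$ of $S$-trees in $G$ is internally disjoint if $E(T_i)\cap E(T_j)=\emptyset$ and $V(T_i)\cap V(T_j)=S$ for all distinct $i,j\in\{1,\dots,\ell\}$. For a connected graph $G$ of order $n$ and an integer $k$ with $2\leq k\leq n$, the generalized $k$-connectivity $\kappa_k(G)$ is the greatest positive integer $r$ such that for every set $S$ of $k$ vertices of $G$, $G$ contains at least $r$ internally disjoint trees connecting $S$. *)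

(* Defs.v *)
From mathcomp Require Import all_boot.

Set Implicit Arguments.
Unset Strict Implicit.
Unset Printing Implicit Defensive.

Record sgraph := SGraph {
  vertex :> finType;
  adj : rel vertex;
  adj_sym : symmetric adj;
  adj_irrefl : irreflexive adj
}.

Definition edges (G : sgraph) : {set {set G}} :=
  [set E : {set G} | [exists x : G, exists y : G, adj x y && (E == [set x; y])]].

Definition connected_graph (G : sgraph) : Prop :=
  0 < #|G| /\ forall x y : G, connect (@adj G) x y.

Definition graph_iso (G H : sgraph) : Prop :=
  exists2 f : G -> H, bijective f & forall x y : G, adj (f x) (f y) = adj x y.

Definition complete_adj (n : nat) : rel 'I_n := fun x y => x != y.

Lemma complete_adj_sym n : symmetric (@complete_adj n).
Proof. by move=> x y; rewrite /complete_adj eq_sym. Qed.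

Lemma complete_adj_irrefl n : irreflexive (@complete_adj n).
Proof. by move=> x; rewrite /complete_adj eqxx. Qed.

Definition complete (n : nat) : sgraph :=
  SGraph (@complete_adj_sym n) (@complete_adj_irrefl n).

Definition del_edge_adj (G : sgraph) (e : {set G}) : rel G :=
  fun x y => adj x y && ([set x; y] != e).

Lemma del_edge_adj_sym (G : sgraph) (e : {set G}) : symmetric (del_edge_adj e).
Proof. by move=> x y; rewrite /del_edge_adj adj_sym setUC. Qed.

Lemma del_edge_adj_irrefl (G : sgraph) (e : {set G}) :
  irreflexive (del_edge_adj e).
Proof. by move=> x; rewrite /del_edge_adj adj_irrefl. Qed.

Definition del_edge (G : sgraph) (e : {set G}) : sgraph :=
  SGraph (@del_edge_adj_sym G e) (@del_edge_adj_irrefl G e).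

Record subgraph (G : sgraph) := Subgraph {
  sub_verts : {set G};
  sub_edges : {set {set G}};
  sub_edgesP : sub_edges \subset edges G;
  sub_edges_verts : forall E : {set G}, E \in sub_edges -> E \subset sub_verts
}.

Definition sub_adj (G : sgraph) (H : subgraph G) : rel G :=
  fun x y => [set x; y] \in sub_edges H.

Definition sub_connected (G : sgraph) (H : subgraph G) : Prop :=
  sub_verts H != set0 /\
  {in sub_verts H &, forall x y : G, connect (sub_adj H) x y}.

(* [ucycle] also holds of the empty sequence and of [:: x; y] for an edge xy,
   so the graph-theoretic cycles are the [ucycle]s of length at least 3. *)
Definition sub_acyclic (G : sgraph) (H : subgraph G) : Prop :=
  forall c : seq G, 2 < size c -> ~ ucycle (sub_adj H) c.

Definition is_tree (G : sgraph) (H : subgraph G) : Prop :=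
  sub_connected H /\ sub_acyclic H.

Definition is_Stree (G : sgraph) (S : {set G}) (H : subgraph G) : Prop :=
  is_tree H /\ S \subset sub_verts H.

Definition internally_disjoint (G : sgraph) (S : {set G}) (l : nat)
    (T : 'I_l -> subgraph G) : Prop :=
  forall i j : 'I_l, i != j ->
    sub_edges (T i) :&: sub_edges (T j) = set0 /\
    sub_verts (T i) :&: sub_verts (T j) = S.

(* Subfamilies of internally disjoint families are internally disjoint, so
   "at least r" trees amounts to a family indexed by 'I_r. *)
Definition has_disjoint_Strees (G : sgraph) (k r : nat) : Prop :=
  forall S : {set G}, #|S| = k ->
    exists T : 'I_r -> subgraph G,
      (forall i : 'I_r, is_Stree S (T i)) /\ internally_disjoint S T.

(* [gen_connectivity G k r] reads "kappa_k(G) = r"; it is meant for connected G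
   and 2 <= k <= #|G|, where exactly one such r exists. *)
Definition gen_connectivity (G : sgraph) (k r : nat) : Prop :=
  [/\ 0 < r, has_disjoint_Strees G k r &
      forall r' : nat, 0 < r' -> has_disjoint_Strees G k r' -> r' <= r].

(* Main.v *)
Require Import Defs.
From mathcomp Require Import all_boot.

(** The theorem says that [kappa_3 = n - 2] exactly when at most one pair of
    distinct vertices is nonadjacent ([one_nonedge]); translating this into
    isomorphisms with the two model graphs is routine.

    Upper bound: for [#|S| = 3] there are never more than [n - 2] internally
    disjoint [S]-trees.  A tree that leaves [S] owns one of the [n - 3] outside
    vertices, while a tree spanning [S] alone takes two of the three possible
    edges inside [S], so at most one such tree exists ([Stree_inside_unique],
    [disjoint_Strees_ub]).

    Necessity: the trees reach a given terminal along distinct edges, so [n - 2]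
    trees force every degree to be at least [n - 2]
    ([disjoint_Strees_neighbors]); hence nonedges are pairwise disjoint.  If
    [xy] and [zw] were disjoint nonedges, take [S = {x, y, z}].  Some tree has
    vertex set [S], for otherwise there are at most [n - 3] of them; since [xy]
    is missing it is the path [x - z - y].  The other [n - 3] trees reach [z]
    through neighbors outside [{x, y, z, w}], of which there are only [n - 4].

    Sufficiency: given a 3-set [S], pick [c] in [S] adjacent to everything.  For
    each of the [n - 2] vertices [w] outside [S] or equal to [c], take the star
    joining [w] to [S].  These stars are internally disjoint; the only thing
    that can go wrong is that the missing edge joins some [w] outside [S] to
    some [v] in [S].  Then the third vertex [d] of [S] is also adjacent to
    everything, and the edge [vd], which no star uses, attaches [v] to the
    others instead ([star_tree]). *)

Set Implicit Arguments.
Unset Strict Implicit.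
Unset Printing Implicit Defensive.

(** * Unordered pairs and edges *)

Lemma set2_inj (T : finType) (x y u v : T) :
  [set x; y] = [set u; v] -> (x = u /\ y = v) \/ (x = v /\ y = u).
Proof.
move=> e.
have: x \in [set u; v] by rewrite -e set21.
have: y \in [set u; v] by rewrite -e set22.
have: u \in [set x; y] by rewrite e set21.
have: v \in [set x; y] by rewrite e set22.
rewrite !inE => /orP[]/eqP? /orP[]/eqP? /orP[]/eqP? /orP[]/eqP?; subst; auto.
Qed.

Lemma cards3_neq (T : finType) (x y z : T) :
  x != y -> x != z -> y != z -> #|[set x; y; z]| = 3.
Proof.
move=> xy xz yz.
by rewrite setUC cardsU1 cards2 !inE negb_or xy ![z == _]eq_sym xz yz.
Qed.

Lemma cards3_ex (T : finType) (S : {set T}) : #|S| = 3 ->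
  exists x y z, [/\ x != y, x != z, y != z & S = [set x; y; z]].
Proof.
move=> S3; have /card_gt2P[x [y [z [[xS yS zS] [xy yz zx]]]]] : 2 < #|S|.
  by rewrite S3.
exists x, y, z; rewrite eq_sym in zx; split=> //; apply/esym/eqP.
by rewrite eqEcard S3 cards3_neq // !subUset !sub1set xS yS zS.
Qed.

Lemma mem_edges (G : sgraph) (x y : G) : ([set x; y] \in edges G) = adj x y.
Proof.
rewrite inE; apply/existsP/idP => [[u /existsP[v /andP[uv /eqP]]]|xy].
  by case/set2_inj=> -[-> ->]; rewrite // adj_sym.
by exists x; apply/existsP; exists y; rewrite xy eqxx.
Qed.

Section Subgraphs.

Variable G : sgraph.

Lemma sub_adj_sym (H : subgraph G) : symmetric (sub_adj H).
Proof. by move=> x y; rewrite /sub_adj setUC. Qed.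

Lemma sub_adj_adj (H : subgraph G) x y : sub_adj H x y -> adj x y.
Proof. by move=> /(subsetP (sub_edgesP H)); rewrite mem_edges. Qed.

Lemma sub_adj_verts (H : subgraph G) x y : sub_adj H x y -> y \in sub_verts H.
Proof. by move=> /sub_edges_verts/subsetP; apply; rewrite set22. Qed.

(** * Trees given by parent functions *)

Section RootedTree.

Variables (V : {set G}) (r : G) (p : G -> G).

Definition parent_edges : {set {set G}} :=
  [set E in edges G | (E \subset V) &&
     [exists v in V, (v != r) && (E == [set v; p v])]].

Lemma parent_edges_sub : parent_edges \subset edges G.
Proof. by apply/subsetP => E; rewrite inE => /andP[]. Qed.

Lemma parent_edges_verts E : E \in parent_edges -> E \subset V.
Proof. by rewrite inE => /and3P[]. Qed.

Definition parent_subgraph : subgraph G :=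
  Subgraph parent_edges_sub parent_edges_verts.

(** The rank [h] replaces induction on the tree: following parents strictly
    decreases it, so one always ends at the root, and a vertex of maximal rank
    on a cycle would have its parent as both of its neighbors. *)
Lemma parent_subgraph_tree (h : G -> nat) :
  r \in V ->
  (forall v, v \in V -> v != r ->
     [/\ p v \in V, adj v (p v) & h (p v) < h v]) ->
  is_tree parent_subgraph.
Proof.
move=> rV pP.
have step v : v \in V -> v != r -> sub_adj parent_subgraph v (p v).
  move=> vV vr; have [pV av _] := pP v vV vr.
  rewrite /sub_adj /= inE mem_edges av subUset !sub1set vV pV /=.
  by apply/existsP; exists v; rewrite vV vr eqxx.
have to_root v : v \in V -> connect (sub_adj parent_subgraph) v r.
  have [m] := ubnP (h v); elim: m v => // m IH v hv vV.
  have [->|vr] := eqVneq v r; first exact: connect0.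
  have [pV _ hp] := pP v vV vr.
  apply: connect_trans (connect1 (step v vV vr)) (IH _ _ pV).
  exact: leq_trans hp _.
split.
  split=> [|x y xV yV]; first by apply/set0Pn; exists r.
  apply: connect_trans (to_root x xV) _.
  by rewrite (sym_connect_sym (@sub_adj_sym _)) to_root.
have nbr v u : sub_adj parent_subgraph v u -> h u <= h v -> u = p v.
  rewrite /sub_adj /= inE => /and3P[_ _ /existsP[t /and3P[tV tr /eqP e]]].
  have [_ _ ht] := pP t tV tr.
  case: (set2_inj e) => -[-> ->] //.
  by rewrite leqNgt ht.
move=> c c3 /andP[cyc uc].
have [v vc vmax] : exists2 v, v \in c & forall u, u \in c -> h u <= h v.
  case: c c3 {cyc uc} => // a c _.
  case: (@arg_maxnP _ a [in a :: c] h (mem_head _ _)) => v vc vm.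
  by exists v.
have [i q rc] := rot_to vc.
have memq u : u \in v :: q -> u \in c by rewrite -rc mem_rot.
have q2 : 1 < size q by rewrite -ltnS -[(size q).+1]/(size (v :: q)) -rc size_rot.
move: cyc uc; rewrite -(rot_cycle i) -(rot_uniq i) rc.
case/lastP: q q2 memq {rc} => // -[|a q] z //= _ memq.
rewrite !rcons_path last_rcons /= => /andP[va /andP[_ zv]].
have ea : a = p v.
  by apply: nbr va (vmax _ (memq _ _)); rewrite !inE eqxx orbT.
have ez : z = p v.
  move: zv; rewrite sub_adj_sym => zv; apply: nbr zv (vmax _ (memq _ _)).
  by rewrite !inE mem_rcons mem_head !orbT.
by rewrite ea ez mem_rcons mem_head /= andbF.
Qed.

End RootedTree.

(** * Upper bound on the number of internally disjoint trees *)

Lemma Stree_incident (S : {set G}) (T : subgraph G) (u v : G) :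
  is_Stree S T -> u \in S -> v \in S -> u != v -> exists w, sub_adj T v w.
Proof.
case=> -[[_ conT] _] /subsetP sST uS vS uv.
have /connectP[[|w s] /= pth e] := conT v u (sST _ vS) (sST _ uS).
  by rewrite e eqxx in uv.
by case/andP: pth => vw _; exists w.
Qed.

Lemma Stree_inside_incident (T : subgraph G) (x y z : G) :
  is_Stree [set x; y; z] T -> sub_verts T = [set x; y; z] -> x != y ->
  sub_adj T x y \/ sub_adj T x z.
Proof.
move=> TS VT xy.
have yx : y != x by rewrite eq_sym.
have [w xw] : exists w, sub_adj T x w.
  by apply: Stree_incident TS _ _ yx; rewrite !inE eqxx ?orbT.
have := sub_adj_verts xw; rewrite VT !inE => /orP[/orP[]|] /eqP wE; subst w.
- by have := sub_adj_adj xw; rewrite adj_irrefl.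
- by left.
- by right.
Qed.

Section Family.

Variables (S : {set G}) (r : nat) (T : 'I_r -> subgraph G).
Hypothesis TS : forall i, is_Stree S (T i).
Hypothesis Tdisj : internally_disjoint S T.

Lemma disjoint_sub_adj i j u v :
  sub_adj (T i) u v -> sub_adj (T j) u v -> i = j.
Proof.
move=> iuv juv; apply/eqP/negPn/negP => /Tdisj[/setP/(_ [set u; v])].
by rewrite inE [in RHS]inE; move: iuv juv; rewrite /sub_adj => -> ->.
Qed.

(** Each tree must leave the terminal [v] to reach [u], and edge-disjointness
    makes the first steps distinct; so [v] has degree at least [r]. *)
Lemma disjoint_Strees_neighbors (u v : G) :
  u \in S -> v \in S -> u != v ->
  exists2 f : 'I_r -> G, injective f & forall i, sub_adj (T i) v (f i).
Proof.
move=> uS vS uv.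
have [f fP] := fin_all_exists (fun i => Stree_incident (TS i) uS vS uv).
exists f => // i j fij; apply: (@disjoint_sub_adj i j v (f i)) => //.
by rewrite fij.
Qed.

(** Choosing for each tree that leaves [S] a vertex outside [S] is injective,
    since distinct trees share only [S]. *)
Lemma card_Strees_outside (A : {set 'I_r}) :
  {in A, forall i, sub_verts (T i) != S} -> #|A| <= #|~: S|.
Proof.
move=> AS.
have ex i : exists w, i \in A -> w \in sub_verts (T i) :\: S.
  have [iA|_] := boolP (i \in A); last first.
    by have [[[/set0Pn[w _] _] _] _] := TS i; exists w.
  have [_ sS] := TS i; have := AS i iA.
  rewrite eqEsubset sS andbT -setD_eq0 => /set0Pn[w wP].
  by exists w.
have [f fP] := fin_all_exists ex.
have finj : {in A &, injective f}.
  move=> i j iA jA fij; apply/eqP/negPn/negP => /Tdisj[_ VS].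
  have /setDP[wi /negP[]] := fP i iA; rewrite -VS inE wi.
  by rewrite fij; have /setDP[] := fP j jA.
rewrite -(card_in_imset finj); apply/subset_leq_card/subsetP => w.
by case/imsetP=> i iA ->; have := fP i iA; rewrite !inE => /andP[].
Qed.

End Family.

(** There are only three possible edges inside [S], and a tree spanning [S]
    uses two of them. *)
Lemma Stree_inside_unique (S : {set G}) (r : nat) (T : 'I_r -> subgraph G) :
  #|S| = 3 -> (forall i, is_Stree S (T i)) -> internally_disjoint S T ->
  forall i j, sub_verts (T i) = S -> sub_verts (T j) = S -> i = j.
Proof.
move/cards3_ex=> [x [y [z [xy xz yz ->]]]] TS Td i j Vi Vj.
(* every vertex of [S] meets an edge, hence two of the three edges are used *)
have cover k : sub_verts (T k) = [set x; y; z] ->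
    [/\ sub_adj (T k) x y \/ sub_adj (T k) x z,
        sub_adj (T k) x y \/ sub_adj (T k) y z
      & sub_adj (T k) x z \/ sub_adj (T k) y z].
  move=> Vk; split.
  - exact: Stree_inside_incident (TS k) Vk xy.
  - have eS : [set x; y; z] = [set y; x; z] by rewrite [[set x; y]]setUC.
    rewrite [sub_adj _ x y]sub_adj_sym.
    by apply: Stree_inside_incident; rewrite ?Vk -?eS // eq_sym.
  - have eS : [set x; y; z] = [set z; x; y] by rewrite setUC setUA.
    rewrite [sub_adj _ x z]sub_adj_sym [sub_adj _ y z]sub_adj_sym.
    by apply: Stree_inside_incident; rewrite ?Vk -?eS // eq_sym.
have D := disjoint_sub_adj Td.
by case: (cover i Vi) => -[?|?] [?|?] [?|?];
   case: (cover j Vj) => -[?|?] [?|?] [?|?]; eauto.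
Qed.

(** The [n - 3] vertices outside [S] allow that many trees leaving [S], and
    there is at most one more. *)
Lemma disjoint_Strees_ub (S : {set G}) (r : nat) (T : 'I_r -> subgraph G) :
  #|S| = 3 -> (forall i, is_Stree S (T i)) -> internally_disjoint S T ->
  r <= #|G| - 2.
Proof.
move=> S3 TS Td.
pose A := [set i | sub_verts (T i) != S].
have cA : #|A| <= #|~: S|.
  by apply: (card_Strees_outside TS Td) => i; rewrite inE.
have cCA : #|~: A| <= 1.
  apply/card_le1_eqP => i j; rewrite !inE !negbK => /eqP Vi /eqP Vj.
  exact: (Stree_inside_unique S3 TS Td).
rewrite -(card_ord r) -(cardsC A) -(cardsC S) S3 addnC addSn subSS subSS subn0.
by rewrite -add1n leq_add.
Qed.

(** * Many disjoint trees exclude a second missing edge *)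

Definition nonedge (x y : G) := (x != y) && ~~ adj x y.

Lemma nonedge_sym : symmetric nonedge.
Proof. by move=> x y; rewrite /nonedge eq_sym adj_sym. Qed.

Definition one_nonedge : Prop :=
  forall x y u v, nonedge x y -> nonedge u v -> [set x; y] = [set u; v].

Section Necessity.

Hypothesis conn : has_disjoint_Strees G 3 (#|G| - 2).

(** Otherwise [x] has at most [n - 3] neighbors, too few for [n - 2] trees. *)
Lemma nonneighbor_unique (x y z : G) :
  nonedge x y -> nonedge x z -> y = z.
Proof.
move=> /andP[xy nxy] /andP[xz nxz]; apply/eqP/negPn/negP => /eqP yz.
have S3 := cards3_neq xy xz (introN eqP yz).
have [T [TS Td]] := conn S3.
have xS : x \in [set x; y; z] by rewrite !inE eqxx.
have yS : y \in [set x; y; z] by rewrite !inE eqxx orbT.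
have yx : y != x by rewrite eq_sym.
have [f finj fP] := disjoint_Strees_neighbors TS Td yS xS yx.
have: f @: [set: 'I_(#|G| - 2)] \subset ~: [set x; y; z].
  apply/subsetP => _ /imsetP[i _ ->]; have := sub_adj_adj (fP i).
  rewrite !inE; apply: contraTN => /orP[/orP[]|] /eqP-> //.
  by rewrite adj_irrefl.
move/subset_leq_card; rewrite card_imset // cardsT card_ord.
have := cardsC [set x; y; z]; rewrite S3 => <-.
by rewrite addSn addSn subSS subSS subn0 ltnn.
Qed.

(** If the nonedges were disjoint, the tree confined to [{x, y, z}] would use up
    both [zx] and [zy], and [z] would have too few neighbors left for the
    other trees. *)
Lemma nonedges_meet (x y z w : G) :
  nonedge x y -> nonedge z w -> z \in [set x; y] \/ w \in [set x; y].
Proof.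
move=> xy zw; apply/orP; apply/negPn/negP; rewrite negb_or => /andP[].
rewrite !inE !negb_or => /andP[zx zy] /andP[wx wy].
have [/andP[nxy axy] /andP[nzw azw]] := (xy, zw).
have [xz yz] : x != z /\ y != z by rewrite ![_ == z]eq_sym.
have S3 := cards3_neq nxy xz yz.
have [T [TS Td]] := conn S3.
(* otherwise every tree owns one of the [n - 3] vertices outside [S] *)
have VS : exists i, sub_verts (T i) = [set x; y; z].
  have [/existsP[i /eqP Vi]|] := boolP [exists i, sub_verts (T i) == [set x; y; z]].
    by exists i.
  rewrite negb_exists => /forallP Vn.
  have /negP[] : ~~ (#|G| - 2 <= #|~: [set x; y; z]|).
    by rewrite -(cardsC [set x; y; z]) S3 ltnn.
  have := card_Strees_outside TS Td (A := setT) (fun i _ => Vn i).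
  by rewrite cardsT card_ord.
have [i0 Vi0] := VS.
(* [xy] is missing, so in this tree both [x] and [y] hang on [z] *)
have i0x : sub_adj (T i0) z x.
  have [/sub_adj_adj|] := Stree_inside_incident (TS i0) Vi0 nxy.
    by rewrite (negbTE axy).
  by rewrite sub_adj_sym.
have i0y : sub_adj (T i0) z y.
  have eS : [set x; y; z] = [set y; x; z] by rewrite [[set x; y]]setUC.
  have := TS i0; rewrite eS => TSi; rewrite eS in Vi0.
  have [|/sub_adj_adj|] := Stree_inside_incident TSi Vi0 _.
  - by rewrite eq_sym.
  - by rewrite adj_sym (negbTE axy).
  by rewrite sub_adj_sym.
have [xS zS] : x \in [set x; y; z] /\ z \in [set x; y; z].
  by rewrite !inE !eqxx !orbT.
have [f finj fP] := disjoint_Strees_neighbors TS Td xS zS xz.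
(* the [n - 3] other trees leave [z] within a set of [n - 4] vertices *)
have: f @: [set~ i0] \subset ~: (w |: [set x; y; z]).
  apply/subsetP => _ /imsetP[i ii0 ->]; have zfi := fP i; move: ii0.
  rewrite !inE; apply: contraNN => /orP[|/orP[/orP[]|]] /eqP fE; rewrite fE in zfi.
  - by have := sub_adj_adj zfi; rewrite (negbTE azw).
  - exact/eqP/(disjoint_sub_adj Td zfi).
  - exact/eqP/(disjoint_sub_adj Td zfi).
  - by have := sub_adj_adj zfi; rewrite adj_irrefl.
move/subset_leq_card; rewrite card_imset // cardsC1 card_ord.
have S4 : #|w |: [set x; y; z]| = 4.
  by rewrite cardsU1 S3 !inE (negbTE wx) (negbTE wy) eq_sym (negbTE nzw).
by rewrite -(cardsC (w |: [set x; y; z])) S4 ltnn.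
Qed.

Lemma connectivity_one_nonedge : one_nonedge.
Proof.
have shared x y v : nonedge x y -> nonedge x v -> [set x; y] = [set x; v].
  by move=> xy xv; rewrite (nonneighbor_unique xy xv).
move=> x y u v xy uv.
have [yx vu] : nonedge y x /\ nonedge v u by rewrite nonedge_sym xy nonedge_sym uv.
have [E F] := (setUC [set x] [set y], setUC [set u] [set v]).
case: (nonedges_meet xy uv); rewrite !inE => /orP[] /eqP e; subst.
- exact: shared.
- by rewrite E; apply: shared.
- by rewrite F; apply: shared.
- by rewrite E F; apply: shared.
Qed.

End Necessity.

(** * A family of near-stars *)

Section Sufficiency.

Variables (S : {set G}) (c d : G).

Definition universal (v : G) := [forall u, (u != v) ==> adj u v].

(** The center [w] may be a vertex outside [S] or the vertex [c] of [S]; a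
    vertex [v] of [S] that [w] misses is attached to [d] instead.  Below, the
    edges [vw] are called spokes and the replacement edges [vd] detours. *)
Definition star_tree (w : G) : subgraph G :=
  parent_subgraph (w |: S) w (fun v => if adj v w then w else d).

Hypothesis one : one_nonedge.
Hypotheses (cS : c \in S) (dS : d \in S) (cd : c != d) (cU : universal c).
Hypothesis dP :
  universal d \/ {in ~: S & S, forall w v, adj v w}.

Lemma universalP v u : universal v -> u != v -> adj u v.
Proof. by move=> /forallP/(_ u)/implyP. Qed.

(** A detour occurs only when the missing edge leaves [S]; both [c] and [d] are
    then off that edge. *)
Lemma star_tree_detour w v :
  w \in c |: ~: S -> v \in S -> v != w -> ~~ adj v w ->
  [/\ universal d, v != c, v != d & w \notin S].
Proof.
rewrite !inE => wW vS vw nvw.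
have wS : w \notin S.
  case/orP: wW => [/eqP wc|//]; subst w.
  by rewrite (universalP cU vw) in nvw.
have dU : universal d.
  case: dP => // /(_ w v); rewrite inE wS vS => /(_ isT isT).
  by rewrite (negbTE nvw).
split=> //; apply: contraNneq nvw => e; subst v; rewrite adj_sym.
  by apply: universalP; rewrite // eq_sym.
by apply: universalP; rewrite // eq_sym.
Qed.

Lemma star_tree_Stree w : w \in c |: ~: S -> is_Stree S (star_tree w).
Proof.
move=> wW; split; last exact: subsetUr.
apply: (@parent_subgraph_tree _ _ _
  (fun v => if v == w then 0 else if adj v w then 1 else 2)).
  exact: setU11.
move=> v; rewrite in_setU1 => /orP[/eqP->|vS] vw; first by rewrite eqxx in vw.
have [vw1|nvw] := boolP (adj v w).
  by rewrite setU11 vw1 eqxx (negbTE vw).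
have [dU vc vd wS] := star_tree_detour wW vS vw nvw.
have wd : w != d by apply: contraNneq wS => ->.
rewrite (universalP dU vd) setU1r // eq_sym (negbTE wd) (negbTE vw).
by rewrite adj_sym (universalP dU wd).
Qed.

(** Two spokes [vw] and [v'w'] with distinct centers can only coincide crosswise,
    which puts both centers in [S] and makes them equal to [c].  A spoke is not a
    detour: it has an end that is [c] or outside [S], while a detour [vd] joins
    two vertices of [S] other than [c].  Equal detours have the same [v], and the
    single nonedge [vw] then determines the center [w]. *)
Lemma star_tree_disjoint w w' :
  w \in c |: ~: S -> w' \in c |: ~: S -> w != w' ->
  sub_edges (star_tree w) :&: sub_edges (star_tree w') = set0 /\
  sub_verts (star_tree w) :&: sub_verts (star_tree w') = S.
Proof.
move=> wW wW' ww'; split; last first.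
  apply/setP => u; rewrite !inE; case: (boolP (u \in S)) => uS; rewrite ?orbT ?orbF //.
  by apply: contraNF ww' => /andP[/eqP<- /eqP<-].
have centerS t : t \in c |: ~: S -> t \in S -> t = c.
  by rewrite !inE => /orP[/eqP//|/negbTE->].
have memS v t : v \in t |: S -> v != t -> v \in S.
  by rewrite in_setU1 => /orP[->|].
have spoke_detour t v u : t \in c |: ~: S -> v \in S -> v != c ->
    [set v; d] = [set u; t] -> False.
  move=> tW vS vc e; have tS : t \in S.
    have: t \in [set v; d] by rewrite e set22.
    by rewrite !inE => /orP[] /eqP->.
  have: c \in [set v; d] by rewrite e -(centerS t tW tS) set22.
  by rewrite !inE eq_sym (negbTE vc) (negbTE cd).
apply/setP => E; rewrite in_set0; apply/negP; rewrite in_setI /= !inE.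
move=> /andP[/and3P[_ _ /existsP[v /and3P[vV vw /eqP Ev]]]].
move=> /and3P[_ _ /existsP[v' /and3P[vV' vw' /eqP]]]; rewrite Ev.
have vS := memS _ _ vV vw; have vS' := memS _ _ vV' vw'.
case: ifPn => [vw1|nvw]; case: ifPn => [vw1'|nvw'].
- case/set2_inj=> -[e1 e2]; first by rewrite e2 eqxx in ww'.
  have wc : w = c by apply: centerS wW _; rewrite e2.
  have wc' : w' = c by apply: centerS wW' _; rewrite -e1.
  by rewrite wc wc' eqxx in ww'.
- have [_ vc' vd' wS'] := star_tree_detour wW' vS' vw' nvw'.
  by move/esym; apply: spoke_detour.
- have [_ vc vd wS] := star_tree_detour wW vS vw nvw.
  exact: spoke_detour.
- have [_ _ vd wS] := star_tree_detour wW vS vw nvw.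
  have [_ _ vd' wS'] := star_tree_detour wW' vS' vw' nvw'.
  case/set2_inj=> -[e1 e2]; last by rewrite e1 eqxx in vd.
  have: [set v; w] = [set v'; w'] by apply: one; apply/andP.
  case/set2_inj=> -[e3 e4]; first by rewrite e4 eqxx in ww'.
  by rewrite e4 vS' in wS.
Qed.

Lemma star_tree_family : exists T : 'I_(#|~: S| + 1) -> subgraph G,
  (forall i, is_Stree S (T i)) /\ internally_disjoint S T.
Proof.
have cW : #|c |: ~: S| = #|~: S| + 1 by rewrite cardsU1 inE cS addnC.
pose g i := enum_val (cast_ord (esym cW) i).
exists (fun i => star_tree (g i)); split=> [i|i j ij].
  exact/star_tree_Stree/enum_valP.
apply: star_tree_disjoint; try exact: enum_valP.
by rewrite (inj_eq enum_val_inj) (inj_eq (@cast_ord_inj _ _ _)).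
Qed.

End Sufficiency.

(** The set [N] of ends of the missing edge has at most two vertices.  If it lies
    inside [S], every center outside [S] is adjacent to all of [S] and any [d]
    will do; otherwise [S] has two vertices outside [N], taken as [c] and [d]. *)
Lemma one_nonedge_disjoint_Strees :
  one_nonedge -> has_disjoint_Strees G 3 (#|G| - 2).
Proof.
move=> one S S3; pose N := [set v | ~~ universal v].
have G2 : #|G| - 2 = #|~: S| + 1 by rewrite -(cardsC S) S3 addn1.
have N2 : #|N| <= 2.
  have [->|/set0Pn[v]] := eqVneq N set0; first by rewrite cards0.
  rewrite inE => /forallPn[u]; rewrite negb_imply => uv.
  apply: leq_trans (_ : #|[set u; v]| <= 2); last by rewrite cards2; case: (_ != _).
  apply/subset_leq_card/subsetP => x; rewrite inE => /forallPn[y].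
  by rewrite negb_imply => yx; rewrite -(one _ _ _ _ yx uv) set22.
have SN : #|S :\: N| + #|S :&: N| = 3 by rewrite addnC cardsID.
suff [c [d [/setDP[cS cN] dS cd dP]]] : exists c d, [/\ c \in S :\: N, d \in S, c != d &
     universal d \/ {in ~: S & S, forall w v, adj v w}].
  by rewrite G2; apply: (@star_tree_family S c d) => //; rewrite inE negbK in cN.
have [NS|] := boolP (N \subset S).
  have: 0 < #|S :\: N|.
    rewrite -(ltn_add2r #|S :&: N|) SN ltnS.
    exact: leq_trans (subset_leq_card (subsetIr _ _)) N2.
  case/card_gt0P=> c cSN; have cS : c \in S by case/setDP: cSN.
  have: 0 < #|S :\ c| by move: S3; rewrite (cardsD1 c) cS add1n => -[->].
  case/card_gt0P=> d /setD1P[dc dS]; exists c, d; split=> //; first by rewrite eq_sym.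
  right=> w v; rewrite inE => wS vS.
  have wU : universal w by apply: contraNT wS => wN; apply: (subsetP NS); rewrite inE.
  by apply: universalP wU _; apply: contraNneq wS => <-.
case/subsetPn=> y yN yS.
have SN1 : #|S :&: N| <= 1.
  rewrite -ltnS; apply: leq_trans N2; apply: proper_card; apply/properP.
  by split; [exact: subsetIr | exists y; rewrite // inE (negbTE yS)].
have /card_gt1P[c [d [cSN dSN cd]]] : 1 < #|S :\: N|.
  by rewrite -(ltn_add2r #|S :&: N|) SN.
exists c, d; case/setDP: (dSN) => dS; rewrite inE negbK => dU.
by split=> //; left.
Qed.

End Subgraphs.

(** * The two model graphs *)

Lemma iso_one_nonedge (G : sgraph) (n : nat) :
  graph_iso G (complete n) \/
  (exists e : {set complete n},
    e \in edges (complete n) /\ graph_iso G (del_edge e)) ->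
  one_nonedge G.
Proof.
case=> [[f bf fP]|[e [eE [f bf fP]]]] x y u v /andP[xy nxy] /andP[uv nuv].
  by move: nxy; rewrite -fP /= /complete_adj (inj_eq (bij_inj bf)) xy.
have missing a b : a != b -> ~~ adj a b -> [set f a; f b] = e.
  move=> ab; rewrite -fP /= /del_edge_adj /= /complete_adj.
  by rewrite (inj_eq (bij_inj bf)) ab negbK => /eqP.
apply: (imset_inj (bij_inj bf)); rewrite !imsetU1 !imset_set1.
by rewrite !missing.
Qed.

Lemma one_nonedge_iso (G : sgraph) :
  one_nonedge G ->
  graph_iso G (complete #|G|) \/
  (exists e : {set complete #|G|},
    e \in edges (complete #|G|) /\ graph_iso G (del_edge e)).
Proof.
move=> one; pose f : G -> complete #|G| := @enum_rank G.
have fB : bijective f by exact: enum_rank_bij.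
have fI := bij_inj fB.
have [/existsP[a /existsP[b ab]]|none] :=
  boolP [exists a : G, exists b : G, nonedge a b].
  right; exists [set f a; f b]; split.
    by rewrite mem_edges /= /complete_adj (inj_eq fI); case/andP: ab.
  exists f => // x y; rewrite /= /del_edge_adj /= /complete_adj (inj_eq fI).
  have [->|xy] := eqVneq x y; first by rewrite adj_irrefl.
  have [xy1|nxy] := boolP (adj x y).
    apply/eqP => e; case/andP: ab => _ /negP[].
    by case: (set2_inj e) => -[/fI<- /fI<-]; rewrite // adj_sym.
  have /(one _ _ _ _ ab) e : nonedge x y by apply/andP.
  apply/negbTE; rewrite negbK; apply/eqP.
  by case: (set2_inj e) => -[-> ->]; rewrite // setUC.
left; exists f => // x y; rewrite /= /complete_adj (inj_eq fI).
have [->|xy] := eqVneq x y; first by rewrite adj_irrefl.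
apply/esym; apply: contraNT none => nxy.
by apply/existsP; exists x; apply/existsP; exists y; apply/andP.
Qed.

(** * The characterization *)

Theorem theorem1 (G : sgraph) (n : nat) (hG : connected_graph G)
    (hn : #|G| = n) (hn3 : 3 <= n) :
  gen_connectivity G 3 (n - 2) <->
  graph_iso G (complete n) \/
  exists e : {set complete n},
    e \in edges (complete n) /\ graph_iso G (del_edge e).
Proof.
subst n; split=> [[_ conn _]|/iso_one_nonedge one].
  exact/one_nonedge_iso/connectivity_one_nonedge.
split; first by rewrite subn_gt0.
  exact: one_nonedge_disjoint_Strees.
move=> r _ conn.
have [S S3] : exists S : {set G}, #|S| = 3.
  have /card_gt2P[x [y [z [_ [xy yz zx]]]]] : 2 < #|G| by [].
  by exists [set x; y; z]; rewrite cards3_neq // eq_sym.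
have [T [TS Td]] := conn S S3.
exact: disjoint_Strees_ub S3 TS Td.
Qed.
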